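(* Let $u:\mathbb{R}^n\to[0,\infty)$ be measurable and let $\mu(dx)=u(x)\,dx$ be the corresponding (not necessarily finite) measure on $\mathbb{R}^n$. Let $f,g:\mathbb{R}^n\to[0,\infty)$ be measurable with $\int g\,d\mu<\infty$. Assume that there exists a change of variables $T:\mathbb{R}^n\to\mathbb{R}^n$ from $ug$ to $uf$ satisfying $$\operatorname*{ess\,inf}_{x\in\mathbb{R}^n}\ \frac{u(x)}{u(T(x))\,|T'(x)|}\ \geq 1 .$$ Then $g\prec_\mu f$.
   Context: Notation: $|T'(x)|$ is the absolute value of the determinant of the derivative of $T$ at $x$. Change of variables: given measurable $\alpha,\beta:\mathbb{R}^n\to[0,\infty)$ with $\int\alpha(x)\,dx<\infty$, a map $T:\mathbb{R}^n\to\mathbb{R}^n$ is a change of variables from $\alpha$ to $\beta$ if $T$ is locally Lipschitz, injective, and $\alpha(x)=\beta(T(x))|T'(x)|$ for Lebesgue almost every $x$. It is understood that such a $T$ transports $\alpha\,dx$ to $\beta\,dx$, i.e. $\int h(T(x))\alpha(x)\,dx=\int h(x)\beta(x)\,dx$ for every measurable $h\ge 0$; in particular $\int\alpha\,dx=\int\beta\,dx$. Essential infimum is with respect to Lebesgue measure; points where the denominator vanishes impose no constraint, so the hypothesis says $u(T(x))|T'(x)|\le u(x)$ for Lebesgue a.e. $x$. Majorization: $g\prec_\mu f$ means that $\int(\varphi(f)-\varphi(g))\,d\mu\ge 0$ for every convex $\varphi:[0,\infty)\to\mathbb{R}$ for which this integral is well defined (equivalently, the signed measure $\sigma=f\#\mu-g\#\mu$,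 the difference of the pushforwards of $\mu$ by $f$ and $g$, satisfies $\int\varphi\,d\sigma\ge0$ for such $\varphi$).
   Formalization: In the definition of majorization, the convex functions φ on [0,∞) are also required to be continuous at 0; without this the claim is false for infinite μ, e.g. for φ equal to 1 at 0 and 0 elsewhere. *)

(* Defs.v *)
From HB Require Import structures.
From mathcomp Require Import all_boot all_order all_algebra.
From mathcomp Require Import all_classical all_reals all_analysis.
From mathcomp Require Import measurable_realfun ess_sup_inf.

Set Implicit Arguments.
Unset Strict Implicit.
Unset Printing Implicit Defensive.

Import Order.TTheory GRing.Theory Num.Theory.
Import numFieldNormedType.Exports.

Local Open Scope classical_set_scope.
Local Open Scope ring_scope.

Section lebesgue_outer.
Context (R : realType) (n : nat).
Local Notation V := 'rV[R]_n.+1.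
Implicit Types (ab : V * V) (A : set V) (F : (V * V)^nat).

(* ab encodes the compact box of the x with ab.1 <= x <= ab.2 coordinatewise. *)
Definition box ab : set V := [set x | forall i, ab.1 0 i <= x 0 i <= ab.2 0 i].

Definition wf_box ab := forall i, ab.1 0 i <= ab.2 0 i.

Definition box_vol ab : \bar R := (\prod_i (ab.2 0 i - ab.1 0 i))%:E.

Definition box_cover A : set ((V * V)^nat) :=
  [set F | (forall k, wf_box (F k)) /\ A `<=` \bigcup_k box (F k)].

Local Open Scope ereal_scope.

Definition lebesgue_outer A : \bar R :=
  ereal_inf [set \sum_(k <oo) box_vol (F k) | F in box_cover A].

Let box_vol_ge0 ab : wf_box ab -> 0 <= box_vol ab.
Proof. by move=> wab; rewrite lee_fin prodr_ge0// => i _; rewrite subr_ge0. Qed.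

Let cover_vol_ge0 A F : box_cover A F -> forall k, 0 <= box_vol (F k).
Proof. by move=> [wF _] k; exact: box_vol_ge0. Qed.

Let le_lebesgue_outer : {homo lebesgue_outer : A B / A `<=` B >-> A <= B}.
Proof.
move=> A B AB; apply/ereal_inf_le_tmp => x [F [wF BF]] <-.
by exists F => //; split => //; exact: subset_trans BF.
Qed.

Let lebesgue_outer_ge0 A : 0 <= lebesgue_outer A.
Proof.
apply: le_ereal_inf_tmp => x [F AF <-].
by apply: nneseries_ge0 => k _ _; exact: cover_vol_ge0 AF k.
Qed.

Let lebesgue_outer0 : lebesgue_outer set0 = 0.
Proof.
apply/eqP; rewrite eq_le lebesgue_outer_ge0 andbT.
apply: ereal_inf_lbound; exists (fun=> (0%R, 0%R)).
  by split => [k i|]; [rewrite lexx|exact: sub0set].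
by apply: eseries0 => k _ _; rewrite /box_vol big_ord_recl/= subrr mul0r.
Qed.

Let lebesgue_outer_sigma_subadditive : sigma_subadditive lebesgue_outer.
Proof.
move=> A; have [[i ioo]|] := pselect (exists i, lebesgue_outer (A i) = +oo).
  rewrite (eseries_pinfty _ _ ioo) ?leey// => k _.
  by rewrite -ltNye (lt_le_trans _ (lebesgue_outer_ge0 _)).
rewrite -forallNE => Aoo.
suff add2e (e : {posnum R}) : lebesgue_outer (\bigcup_k A k) <=
    \sum_(i <oo) lebesgue_outer (A i) + e%:num%:E.
  by apply/lee_addgt0Pr => _/posnumP[].
rewrite (le_trans _ (epsilon_trick _ _ _))//.
pose P k F := box_cover (A k) F /\ \sum_(j <oo) box_vol (F j) <=
  lebesgue_outer (A k) + (e%:num / (2 ^ k.+1)%:R)%:E.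
have [G PG] : {G : nat -> (V * V)^nat & forall k, P k (G k)}.
  apply: (@choice _ _ P) => k; rewrite /P /lebesgue_outer.
  set S := (X in ereal_inf X); move infS : (ereal_inf S) => iS.
  case: iS infS => [r Sr|Soo|Soo].
  - have en1 : (0 < e%:num / (2 ^ k.+1)%:R)%R by [].
    have /(lb_ereal_inf_adherent en1) : ereal_inf S \is a fin_num by rewrite Sr.
    move=> [x [F AF volF] xS].
    by exists F; split => //; rewrite volF -Sr; exact/ltW.
  - by have := Aoo k; rewrite /lebesgue_outer -/S Soo.
  - by have := lebesgue_outer_ge0 (A k); rewrite /lebesgue_outer -/S Soo.
have G_ge0 x : 0 <= (box_vol \o uncurry G) x.
  by case: x => i j; exact: cover_vol_ge0 (PG i).1 j.
apply: (@le_trans _ _ (\esum_(i in setT) (box_vol \o uncurry G) i)).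
  apply: ereal_inf_lbound => /=.
  have /card_esym/ppcard_eqP[f] := card_nat2.
  exists (uncurry G \o f).
    split => [i|]; first by rewrite /=; case: (f i) => k j; exact: (PG k).1.1.
    apply: (@subset_trans _ (\bigcup_k \bigcup_j box (G k j))) => [t [i _]|].
      by move=> /((PG i).1.2) -[j _ ?]; exists i => //; exists j.
    move=> t [i _ [j _ Gijt]]; exists (f^-1%FUN (i, j)) => //=.
    by rewrite invK ?inE.
  rewrite -(esum_pred_image (box_vol \o uncurry G) _ xpredT) ?[fun=> _]set_true//.
  by rewrite image_eq.
rewrite (_ : esum _ _ = \sum_(i <oo) \sum_(j <oo) box_vol (G i j)); last first.
  pose J : nat -> set (nat * nat) := fun i => [set (i, j) | j in setT].
  rewrite (_ : setT = \bigcup_k J k); last first.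
    by rewrite predeqE => -[a b]; split => // _; exists a => //; exists b.
  rewrite esum_bigcupT /=; last 2 first.
  - apply/trivIsetP => i j _ _ ij.
    rewrite predeqE => -[k m] /=; split => //= -[] [_] _ [<-{k} _].
    by move=> [m' _] [] /esym/eqP; rewrite (negbTE ij).
  - by move=> x; exact: G_ge0.
  rewrite -(image_id [set: nat]) -fun_true esum_pred_image//; last first.
    by move=> k _; apply: esum_ge0 => x _; exact: G_ge0.
  apply: eq_eseriesr => /= j _.
  rewrite -(esum_pred_image (box_vol \o uncurry G) (pair j) predT)//=; last 2 first.
  - by move=> k _; exact: (G_ge0 (j, k)).
  - by move=> ? ? _ _; exact: (@can_inj _ _ _ snd).
  by congr esum; rewrite predeqE => -[a b]; split; move=> [i _ <-]; exists i.
apply: lee_nneseries => [i _ _|i _].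
- by apply: nneseries_ge0 => m _ _; exact: (G_ge0 (i, m)).
- exact: (PG i).2.
Qed.

HB.instance Definition _ := isOuterMeasure.Build R V lebesgue_outer
  lebesgue_outer0 lebesgue_outer_ge0 le_lebesgue_outer
  lebesgue_outer_sigma_subadditive.

Definition lebesgue_outer_measure : {outer_measure set V -> \bar R} :=
  [the outer_measure R V of lebesgue_outer].

End lebesgue_outer.

(* R^n.+1 with the sigma-algebra of Lebesgue measurable sets, i.e., those that
   are Caratheodory measurable for the outer measure above; this is a copy of
   'rV[R]_n.+1, which has no measurable structure of its own. *)
Notation lebesgue_space R n := (caratheodory_type (lebesgue_outer_measure R n)).

Definition lebesgue_mu (R : realType) (n : nat) :
  {measure set (lebesgue_space R n) -> \bar R} :=
  [the measure _ _ of
    (lebesgue_outer_measure R n : set (lebesgue_space R n) -> \bar R)].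

Definition lebesgue_measurable (R : realType) (n : nat)
    (h : 'rV[R]_n.+1 -> R) :=
  measurable_fun [set: lebesgue_space R n] (h : lebesgue_space R n -> R).

Section density.
Local Open Scope ereal_scope.
Context d (T : measurableType d) (R : realType).
Variable nu : {measure set T -> \bar R}.
Variables (u : T -> R) (mu : measurable_fun [set: T] u).
Variable (u0 : forall x, (0 <= u x)%R).

(* The measure u(x) nu(dx). *)
Definition density_measure of measurable_fun [set: T] u & (forall x, (0 <= u x)%R) :=
  fun A : set T => \int[nu]_(x in A) (u x)%:E.

Local Notation m := (density_measure mu u0).

Let density0 : m set0 = 0.
Proof. exact: integral_set0. Qed.

Let density_ge0 A : 0 <= m A.
Proof. by apply: integral_ge0 => x _; rewrite lee_fin. Qed.

Let density_sigma_additive : semi_sigma_additive m.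
Proof.
move=> F mF tF mUF; rewrite /density_measure ge0_integral_bigcup//; last 2 first.
- by apply/measurable_EFinP; exact: measurable_funTS.
- by move=> x _; rewrite lee_fin.
by apply: is_cvg_nneseries => k _ _; exact: density_ge0.
Qed.

HB.instance Definition _ := isMeasure.Build d T R m
  density0 density_ge0 density_sigma_additive.

End density.

Definition locally_lipschitz (R : realType) (n : nat)
    (T : 'rV[R]_n.+1 -> 'rV[R]_n.+1) :=
  forall x : 'rV[R]_n.+1, exists2 U, nbhs x U & [lipschitz T y | y in U].

(* |T'(x)|; 'J T x is the matrix of the differential, with an arbitrary value
   where T is not differentiable, which for a locally Lipschitz T happens only
   on a Lebesgue-negligible set. *)
Definition abs_jac (R : realType) (n : nat)
    (T : 'rV[R]_n.+1 -> 'rV[R]_n.+1) (x : 'rV[R]_n.+1) : R :=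
  `|\det ('J T x)|.

(* The last clause does not follow from the previous ones: when T is not
   surjective they say nothing of beta outside the range of T. *)
Definition change_of_variables (R : realType) (n : nat)
    (alpha beta : 'rV[R]_n.+1 -> R) (T : 'rV[R]_n.+1 -> 'rV[R]_n.+1) :=
  [/\ locally_lipschitz T,
      injective T,
      \forall x \ae lebesgue_mu R n, alpha x = beta (T x) * abs_jac T x &
      forall h, lebesgue_measurable h -> (forall x, 0 <= h x) ->
        (\int[lebesgue_mu R n]_x (h (T x) * alpha x)%:E =
         \int[lebesgue_mu R n]_x (h x * beta x)%:E)%E].

(* a / b, read as +oo when b = 0 (also when a = b = 0), so that points where
   the denominator vanishes do not constrain an essential infimum. *)
Definition ext_ratio (R : realType) (a b : R) : \bar R :=
  if b == 0 then +oo%E else (a / b)%:E.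

(* g is majorized by f with respect to mu. The integral is well defined when its
   positive and negative parts are not both infinite. A convex function on
   [0, +oo[ is continuous except possibly at 0; continuity at 0 has to be
   required, for phi equal to 1 at 0 and to 0 elsewhere would compare
   mu (f @^-1` [set 0]) with mu (g @^-1` [set 0]), which need not be ordered
   when mu is infinite. *)
Definition majorized d (X : measurableType d) (R : realType)
    (mu : {measure set X -> \bar R}) (g f : X -> R) :=
  forall phi : R -> R,
    convex_function (`[0, +oo[%classic : set R) phi ->
    phi t @[t --> 0^'+] --> phi 0 ->
    let k x := (phi (f x) - phi (g x))%:E in
    (\int[mu]_x (k^\+ x) < +oo \/ \int[mu]_x (k^\- x) < +oo)%E ->
    (0 <= \int[mu]_x k x)%E.

(* Main.v *)
(* On [u g > 0] the two hypotheses on [T] give [g <= f \o T]. Write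
   [phi t - phi 0 = t * psi t] with [psi] nondecreasing. If [psi] is bounded,
   transporting [u g] to [u f] yields
   [\int phi(f) - phi(0) = \int psi(f \o T) g >= \int psi(g) g = \int phi(g) - phi(0)]
   with respect to [u dx], all integrals being finite since [f] and [g] have the
   same finite integral.
   A general [phi] is the limit of Lipschitz convex functions [chi], obtained by
   continuing [phi] along its tangents outside [1/n, n]. The increments of
   [phi - chi] and [chi] have the same sign on each side of a minimum of [phi],
   so that [chi(f) - chi(g)] is bounded above by [(phi(f) - phi(g))^+ + K (f + g)]
   with [K] independent of [n] (chords instead of tangents would not do), and
   Fatou's lemma concludes. *)
Require Import Defs.
From mathcomp Require Import all_boot all_order all_algebra.
From mathcomp Require Import all_classical all_reals all_analysis.
From mathcomp Require Import measurable_realfun ess_sup_inf.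
From mathcomp Require Import ring lra.
Set Implicit Arguments.
Unset Strict Implicit.
Import Order.TTheory GRing.Theory Num.Theory.
Import numFieldNormedType.Exports.
Local Open Scope classical_set_scope.
Local Open Scope ring_scope.

(** * Chords and supporting lines of convex functions on the half-line *)

Lemma convex_function_chord (R : realType) (phi : R -> R) :
    convex_function (`[0, +oo[%classic : set R) phi ->
  forall x y z : R, 0 <= x -> x < y -> y < z ->
    phi y * (z - x) <= phi x * (z - y) + phi z * (y - x).
Proof.
move=> cphi x y z x0 xy yz.
have zx : 0 < z - x by lra.
have t01 : 0 <= (z - y) / (z - x) <= 1.
  by rewrite ler_pdivrMr// divr_ge0/=; lra.
have xI : x \in (`[0, +oo[%classic : set R) by rewrite inE/= in_itv/= x0.
have zI : z \in (`[0, +oo[%classic : set R).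
  by rewrite inE/= in_itv/= andbT; lra.
have := cphi (Itv01 (andP t01).1 (andP t01).2) x z xI zI.
rewrite !convRE/= -(ler_pM2r zx) /unstable.onem.
set w := (X in phi X); have -> : w = y.
  rewrite (_ : w = (z - y) / (z - x) * x + (1 - (z - y) / (z - x)) * z)//.
  by field; lra.
move=> /le_trans; apply; rewrite le_eqVlt; apply/orP; left; apply/eqP.
by field; lra.
Qed.

(** By the chord inequality every slope from the left of [y] is a lower bound of the slopes to its
    right, so the infimum of the latter is a supporting slope. Since [0 < y], there is a point on
    the left, and the infimum is finite. *)
Lemma convex_subgradient (R : realType) (phi : R -> R) :
    convex_function (`[0, +oo[%classic : set R) phi ->
  forall y : R, 0 < y -> exists d : R, forall z : R, 0 <= z -> phi y + d * (z - y) <= phi z.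
Proof.
move=> /convex_function_chord cphi y y0.
pose S := [set (phi z - phi y) / (z - y) | z in [set z | y < z]].
have S_lb x : 0 <= x -> x < y -> lbound S ((phi y - phi x) / (y - x)).
  move=> x0 xy _ [z /= yz <-].
  rewrite ler_pdivlMr ?subr_gt0// mulrAC ler_pdivrMr ?subr_gt0//.
  by have := cphi x y z x0 xy yz; nra.
have S0 : S !=set0.
  by exists ((phi (y + 1) - phi y) / (y + 1 - y)); exists (y + 1) => //=; lra.
exists (inf S) => z z0; have [zy|yz|->] := ltgtP z y; last by rewrite subrr mulr0 addr0.
- have := lb_le_inf S0 (S_lb _ z0 zy).
  by rewrite ler_pdivrMr ?subr_gt0//; nra.
- have : inf S <= (phi z - phi y) / (z - y).
    by apply: ge_inf; [exists ((phi y - phi 0) / (y - 0)); exact: S_lb|exists z].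
  by rewrite ler_pdivlMr ?subr_gt0//; nra.
Qed.

(** * Lipschitz truncation of convex functions by tangents *)

Section tangent_extension.
Context (R : realType) (phi D : R -> R).
Hypothesis subg : forall x y : R, 0 < x -> 0 <= y -> phi x + D x * (y - x) <= phi y.

Lemma subgradient_le (x y : R) : 0 < x -> x <= y -> D x <= D y.
Proof.
move=> x0; rewrite le_eqVlt => /predU1P[->//|xy].
have := subg x0 (ltW (lt_trans x0 xy)).
by have := subg (lt_trans x0 xy) (ltW x0); nra.
Qed.

(** The slopes of [phi] may be unbounded near 0 and at infinity; following the supporting lines at
    [a] and [b] keeps them between [D a] and [D b]. *)
Definition tangent_ext (a b t : R) :=
  if t <= a then phi a + D a * (t - a)
  else if t <= b then phi t else phi b + D b * (t - b).

Definition tangent_slope (a b t : R) :=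
  if t <= a then D a else if t <= b then D t else D b.

(** When [y] lies in an affine piece other than that of [x], the supporting line is compared with
    the graph at the endpoint [a] or [b] of that piece; beyond it the monotonicity of [D]
    decides. *)
Lemma tangent_ext_subgradient (a b x y : R) : 0 < a -> a <= b -> 0 <= x -> 0 <= y ->
  tangent_ext a b x + tangent_slope a b x * (y - x) <= tangent_ext a b y.
Proof.
move=> a0 ab x0 y0; have b0 := lt_le_trans a0 ab; have Dab := subgradient_le a0 ab.
rewrite /tangent_ext /tangent_slope.
have [xa|ax] := leP x a; have [ya|ay] := leP y a.
- by rewrite le_eqVlt -subr_eq0; apply/orP; left; apply/eqP; ring.
- have [yb|yb] := leP y b; first by have := subg a0 y0; lra.
  by have := subg a0 (ltW b0); nra.
- have x0' := lt_trans a0 ax; have Dax := subgradient_le a0 (ltW ax).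
  have [xb|xb] := leP x b; first by have := subg x0' (ltW a0); nra.
  by have := subg b0 (ltW a0); nra.
- have x0' := lt_trans a0 ax.
  have [xb|xb] := leP x b; have [yb|yb] := leP y b.
  + exact: subg.
  + by have := subg x0' (ltW b0); have := subgradient_le x0' xb; nra.
  + by have := subg b0 y0; lra.
  + lra.
Qed.

Lemma tangent_slope_bounds (a b x : R) : 0 < a -> a <= b ->
  D a <= tangent_slope a b x <= D b.
Proof.
move=> a0 ab; rewrite /tangent_slope; case: (leP x a) => [_|ax].
  by rewrite lexx subgradient_le.
by case: (leP x b) => xb; rewrite ?lexx !subgradient_le//; lra.
Qed.

Lemma tangent_ext_le (a b x : R) : 0 < a -> a <= b -> 0 <= x ->
  tangent_ext a b x <= phi x.
Proof.
move=> a0 ab x0; rewrite /tangent_ext; case: (leP x a) => _; first exact: subg.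
by case: (leP x b) => // _; apply: subg => //; exact: lt_le_trans ab.
Qed.

(** The normalization makes 1 a minimum of [phi], with value 0. On either side of 1, [phi] and its
    continuation vary in the same direction, and [phi] varies at least as much. Across 1,
    [x + y > 1] and the values of [phi] on [[0, 1]] are at most [phi 0], which is therefore a
    sufficient constant for all [a] and [b]. *)
Lemma tangent_ext_diff_le (a b x y : R) : phi 1 = 0 -> D 1 = 0 ->
    0 < a -> a <= 1 -> 1 <= b -> 0 <= x -> 0 <= y ->
  tangent_ext a b x - tangent_ext a b y <=
    Num.max (phi x - phi y) 0 + phi 0 * (x + y).
Proof.
move=> phi1 D1 a0 a1 b1; set chi := tangent_ext a b.
have ab : a <= b by exact: le_trans b1.
have b0 : 0 < b by exact: lt_le_trans ab.
have Da : D a <= 0 by rewrite -D1 subgradient_le.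
have Db : 0 <= D b by rewrite -D1 subgradient_le.
have phi_ge0 z : 0 <= z -> 0 <= phi z.
  by move=> z0; have := subg ltr01 z0; rewrite phi1 D1 mul0r addr0.
have phi_le0 z : 0 <= z -> z <= 1 -> phi z <= phi 0.
  rewrite le_eqVlt => /predU1P[<-//|z0] z1.
  by have := subg z0 (lexx 0); have := subgradient_le z0 z1; rewrite D1; nra.
have chi_ge0 z : 0 <= z -> 0 <= chi z.
  move=> z0; rewrite /chi /tangent_ext.
  have := phi_ge0 _ (ltW a0); have := phi_ge0 _ (ltW b0); have := phi_ge0 _ z0.
  by case: (leP z a) => za; [nra|case: (leP z b) => zb; nra].
have chi_left z w : 0 <= z -> z <= w -> w <= 1 ->
    chi w <= chi z /\ chi z - chi w <= phi z - phi w.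
  move=> z0 zw w1; split.
    have := tangent_ext_subgradient a0 ab (le_trans z0 zw) z0.
    suff : tangent_slope a b w <= 0 by rewrite /chi; nra.
    rewrite /tangent_slope; case: (leP w a) => // aw.
    case: (leP w b) => wb; last lra.
    by rewrite -D1 subgradient_le//; lra.
  have := tangent_ext_le a0 ab z0.
  rewrite /chi [tangent_ext a b w]/tangent_ext; case: (leP w a) => wa.
    rewrite [tangent_ext a b z]/tangent_ext ifT; last lra.
    (* No supporting line is given at 0, so [w = 0] is treated apart; it forces [z = w]. *)
    have [w0|w0] := leP w 0; first by (have -> : z = w by lra); lra.
    by have := subg w0 z0; have := subgradient_le w0 wa; nra.
  by case: (leP w b) => wb; lra.
have chi_right z w : 1 <= w -> w <= z ->
    chi w <= chi z /\ chi z - chi w <= phi z - phi w.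
  move=> w1 wz; have w0 : 0 < w by lra. have z0 : 0 < z by lra. split.
    have := tangent_ext_subgradient a0 ab (ltW w0) (ltW z0).
    suff : 0 <= tangent_slope a b w by rewrite /chi; nra.
    rewrite /tangent_slope; case: (leP w a) => wa.
      by (have -> : a = 1 by lra); rewrite D1.
    by case: (leP w b) => // wb; rewrite -D1 subgradient_le.
  have := tangent_ext_le a0 ab (ltW z0).
  rewrite /chi [tangent_ext a b w]/tangent_ext; case: (leP w a) => wa.
    by (have -> : a = w by lra); lra.
  case: (leP w b) => wb; first lra.
  rewrite [tangent_ext a b z]/tangent_ext ifF; last first.
    by apply/negbTE; rewrite -ltNge; lra.
  rewrite ifF; last by apply/negbTE; rewrite -ltNge; lra.
  by have := subg w0 (ltW z0); have := subgradient_le b0 (ltW wb); nra.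
move=> x0 y0.
have p0 := phi_ge0 _ (lexx 0).
have px := phi_ge0 _ x0; have py := phi_ge0 _ y0.
have cx := chi_ge0 _ x0; have cy := chi_ge0 _ y0.
have cpx : chi x <= phi x by exact: tangent_ext_le.
have m1 : phi x - phi y <= Num.max (phi x - phi y) 0 by rewrite le_max lexx.
have m0 : 0 <= Num.max (phi x - phi y) 0 by rewrite le_max lexx orbT.
have [x1|x1] := leP x 1; have [y1|y1] := leP y 1.
- have [xy|yx] := leP x y; first by have [_] := chi_left _ _ x0 xy y1; nra.
  by have [] := chi_left _ _ y0 (ltW yx) x1; nra.
- by have := phi_le0 _ x0 x1; nra.
(* Here [chi x <= phi x = (phi x - phi y) + phi y], and [phi y <= phi 0 <= phi 0 * (x + y)]. *)
- by have := phi_le0 _ y0 y1; nra.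
- have [yx|xy] := leP y x.
    by have [_] := chi_right _ _ (ltW y1) yx; nra.
  by have [] := chi_right _ _ (ltW x1) (ltW xy); nra.
Qed.

End tangent_extension.

(** For [x > 0] the sequence is eventually constant. At 0 it is squeezed between [phi n.+1%:R^-1]
    and [phi 0]: [D 1 <= 0] makes the slopes near 0 nonpositive, so the tangent does not descend
    towards 0. This is where continuity of [phi] at 0 enters. *)
Lemma tangent_ext_cvg (R : realType) (phi D : R -> R) (x : R) :
    (forall x y : R, 0 < x -> 0 <= y -> phi x + D x * (y - x) <= phi y) ->
    D 1 <= 0 ->
    phi t @[t --> 0^'+] --> phi 0 -> 0 <= x ->
  tangent_ext phi D n.+1%:R^-1 n.+1%:R x @[n --> \oo] --> phi x.
Proof.
move=> subg D1 phi0; rewrite le_eqVlt => /predU1P[<-|x0].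
  have phia : phi n.+1%:R^-1 @[n --> \oo] --> phi 0.
    move/cvg_at_rightP : phi0; apply; split=> [n|]; first by rewrite invr_gt0.
    exact: cvg_harmonic.
  apply: (squeeze_cvgr _ phia (cvg_cst _)); near=> n.
  have n0 : 0 < n.+1%:R^-1 :> R by rewrite invr_gt0.
  have n1 : n.+1%:R^-1 <= 1 :> R by rewrite invf_le1// ler1n.
  rewrite /tangent_ext (ltW n0); apply/andP; split; last exact: subg.
  have Dn : D n.+1%:R^-1 <= 0 by apply: le_trans D1; exact: (subgradient_le subg).
  by rewrite sub0r mulrN -mulNr lerDl mulr_ge0 ?oppr_ge0// ltW.
apply: cvg_near_cst; near=> n.
rewrite /tangent_ext ifF.
  rewrite ifT//; near: n; apply: filterS (nbhs_infty_ger x) => n xn.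
  by rewrite (le_trans xn)// ler_nat.
apply/negbTE; rewrite -ltNge.
by near: n; exact: (near_infty_natSinv_lt (PosNum x0)).
Unshelve. all: by end_near. Qed.

(** The three clauses serve, in this order, the Lipschitz case, the integrable majorant and the
    passage to the limit. *)
Lemma convex_truncation (R : realType) (phi : R -> R) :
    convex_function (`[0, +oo[%classic : set R) phi ->
    phi t @[t --> 0^'+] --> phi 0 ->
  exists chi : nat -> R -> R, [/\
    forall n, exists2 E : R -> R, exists C, forall x, `|E x| <= C &
      forall x y, 0 <= x -> 0 <= y -> chi n x + E x * (y - x) <= chi n y,
    exists2 K, 0 <= K & forall n x y, 0 <= x -> 0 <= y ->
      chi n x - chi n y <= Num.max (phi x - phi y) 0 + K * (x + y) &
    forall x, 0 <= x -> chi n x @[n --> \oo] --> phi x].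
Proof.
move=> cphi phi0.
have [D subg] : {D : R -> R & forall x, 0 < x ->
    forall y, 0 <= y -> phi x + D x * (y - x) <= phi y}.
  apply: (@choice _ _ (fun x d => 0 < x ->
    forall y, 0 <= y -> phi x + d * (y - x) <= phi y)) => x.
  have [x0|x0] := ltP 0 x; last by exists 0.
  by have [d dP] := convex_subgradient cphi x0; exists d.
have {}subg x y : 0 < x -> 0 <= y -> phi x + D x * (y - x) <= phi y.
  by move=> x0; exact: subg.
(* Subtracting the tangent at 1 gives a function with minimum 0 at 1; the tangent is added back to
   the truncations. *)
pose psi t := phi t - phi 1 - D 1 * (t - 1).
pose E t := D t - D 1.
have subgE x y : 0 < x -> 0 <= y -> psi x + E x * (y - x) <= psi y.
  by move=> x0 y0; have := subg _ _ x0 y0; rewrite /psi /E; lra.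
have psi1 : psi 1 = 0 by rewrite /psi; ring.
have E1 : E 1 = 0 by rewrite /E subrr.
pose a n : R := n.+1%:R^-1.
have a0 n : 0 < a n by rewrite invr_gt0.
have a1 n : a n <= 1 by rewrite invf_le1// ler1n.
have b1 n : 1 <= n.+1%:R :> R by rewrite ler1n.
exists (fun n t => tangent_ext psi E (a n) n.+1%:R t + (phi 1 + D 1 * (t - 1))).
split.
- move=> n; have ab := le_trans (a1 n) (b1 n).
  exists (fun x => tangent_slope E (a n) n.+1%:R x + D 1).
    exists (`|E (a n)| + `|E n.+1%:R| + `|D 1|) => x.
    have := tangent_slope_bounds subgE x (a0 n) ab.
    set s := tangent_slope _ _ _ _ => /andP[s1 s2].
    apply: (le_trans (ler_normD _ _)); rewrite lerD2r.
    have := ler_norm (E n.+1%:R); have := lerNnormlW (lexx `|E (a n)|).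
    have := normr_ge0 (E n.+1%:R); have := normr_ge0 (E (a n)).
    by rewrite ler_norml; lra.
  move=> x y x0 y0.
  by have := tangent_ext_subgradient subgE (a0 n) ab x0 y0; lra.
- have psi0 : 0 <= psi 0 by have := subgE _ _ ltr01 (lexx 0); rewrite psi1 E1; lra.
  (* One [|D 1|] pays for the tangent added back, the other for replacing [psi] by [phi] in the
     maximum. *)
  exists (psi 0 + 2 * `|D 1|); first by rewrite addr_ge0// mulr_ge0.
  move=> n x y x0 y0.
  have := tangent_ext_diff_le subgE psi1 E1 (a0 n) (a1 n) (b1 n) x0 y0.
  have d1 : `|D 1 * (x - y)| <= `|D 1| * (x + y).
    by rewrite normrM ler_wpM2l// ler_norml; lra.
  have := ler_norm (D 1 * (x - y)).
  have := lerNnormlW d1.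
  have -> : psi x - psi y = phi x - phi y - D 1 * (x - y) by rewrite /psi; ring.
  have [|] := leP (phi x - phi y - D 1 * (x - y)) 0;
    have [|] := leP (phi x - phi y) 0; lra.
- move=> x x0.
  rewrite (_ : phi x = psi x + (phi 1 + D 1 * (x - 1))); last by rewrite /psi; ring.
  apply: cvgD; last exact: cvg_cst.
  apply: tangent_ext_cvg => //; first by rewrite E1.
  apply: cvgB; first by apply: cvgB => //; exact: cvg_cst.
  apply: cvgM; first exact: cvg_cst.
  apply: cvgB; last exact: cvg_cst.
  exact/cvg_at_right_filter/cvg_id.
Qed.

(** * Integrals against a density and almost everywhere comparison *)

Section integral_lemmas.
Local Open Scope ereal_scope.
Context d (X : measurableType d) (R : realType).

Import HBNNSimple.

(** Both sides are limits along an increasing sequence of simple functions; on the indicator of a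
    level set the identity is the definition of [density_measure]. *)
Lemma ge0_integral_density_measure (nu : {measure set X -> \bar R})
    (u : X -> R) (mu : measurable_fun [set: X] u)
    (u0 : forall x, (0 <= u x)%R) (h : X -> \bar R) :
    measurable_fun [set: X] h -> (forall x, 0 <= h x) ->
  \int[density_measure nu mu u0]_x h x = \int[nu]_x (h x * (u x)%:E).
Proof.
move=> mh h0; set m := density_measure nu mu u0.
have meu : measurable_fun [set: X] (EFin \o u) by exact/measurable_EFinP.
pose s := nnsfun_approx measurableT mh.
have ms n : measurable_fun [set: X] (EFin \o s n) by exact/measurable_EFinP.
have s_cvg x : (EFin \o s n) x @[n --> \oo] --> h x by exact: cvg_nnsfun_approx.
have -> : \int[m]_x h x = limn (fun n => \int[m]_x (EFin \o s n) x).
  rewrite -monotone_convergence//.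
  - by apply: eq_integral => x _; exact/esym/cvg_lim.
  - by move=> n x _; rewrite lee_fin.
  - by move=> x _ a b ab; rewrite lee_fin; exact/lefP/nd_nnsfun_approx.
have -> : \int[nu]_x (h x * (u x)%:E) =
    limn (fun n => \int[nu]_x ((EFin \o s n) x * (u x)%:E)).
  rewrite -monotone_convergence//.
  - by apply: eq_integral => x _; apply/esym/cvg_lim => //; exact: cvgeZr.
  - by move=> n; exact: emeasurable_funM.
  - by move=> n x _; rewrite mule_ge0 ?lee_fin.
  - move=> x _ a b ab; rewrite lee_wpmul2r ?lee_fin//.
    exact/lefP/nd_nnsfun_approx.
congr (limn _); apply/funext => n.
have ind0 y x : 0 <= (y * \1_(s n @^-1` [set y]) x)%:E.
  exact: nnfun_muleindic_ge0.
have mind y : measurable_fun [set: X] (fun x => (y * \1_(s n @^-1` [set y]) x)%:E).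
  by apply/measurable_EFinP; exact: measurable_funM.
transitivity (\int[m]_x
    (\sum_(y \in range (s n)) (y * \1_(s n @^-1` [set y]) x)%:E)).
  by apply: eq_integral => x _; rewrite /= fimfunE -fsumEFin.
rewrite ge0_integral_fsum//.
transitivity (\int[nu]_x (\sum_(y \in range (s n))
    (y * \1_(s n @^-1` [set y]) x)%:E * (u x)%:E)); last first.
  apply: eq_integral => x _.
  by rewrite -ge0_mule_fsuml// fsumEFin// -(fimfunE _ x).
rewrite ge0_integral_fsum//; last 2 first.
  - by move=> y; exact: emeasurable_funM.
  - by move=> y x _; rewrite mule_ge0 ?ind0 ?lee_fin.
apply: eq_fsbigr => r rs.
under eq_integral do rewrite EFinM.
rewrite integralZl_indic_nnsfun//= integral_indic// setIT.
under [RHS]eq_integral do rewrite EFinM -muleA.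
rewrite ge0_integralZl//.
- congr (_ * _); transitivity (\int[nu]_(x in s n @^-1` [set r]) (u x)%:E) => //.
  rewrite integral_mkcond.
  by apply: eq_integral => x _; rewrite muleC epatch_indic.
- by apply: emeasurable_funM => //; exact/measurable_EFinP.
- by move=> x _; rewrite mule_ge0 ?lee_fin.
- by move: rs; rewrite inE => -[x _ <-]; rewrite lee_fin.
Qed.

(* [h2] need not be measurable: its integral is then a lower integral. *)
Lemma ae_le_lower_integral (nu : {measure set X -> \bar R}) (h1 h2 : X -> \bar R) :
    measurable_fun [set: X] h1 -> (forall x, 0 <= h1 x) ->
    (forall x, 0 <= h2 x) -> (\forall x \ae nu, h1 x <= h2 x) ->
  \int[nu]_x h1 x <= \int[nu]_x h2 x.
Proof.
move=> mh1 h10 h20 [N [mN N0 hN]].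
(* The null set [N] is removed from the integral of [h1] only: a simple function below [h1] off [N]
   and vanishing on [N] is below [h2] everywhere. *)
rewrite (ge0_negligible_integral mN)// setTD integral_mkcond.
rewrite !ge0_integralTE//; last first.
  by move=> x; rewrite /patch; case: ifP.
apply: le_ereal_sup => _ [s /= sh <-]; exists s => // x.
apply: (le_trans (sh x)); rewrite /patch; case: ifPn => //.
rewrite inE /setC /= => Nx; apply: contrapT => h12.
exact/Nx/hN.
Qed.

End integral_lemmas.

(** * Majorization from inequalities with nondecreasing weights *)

Section majorization.
Context d (X : measurableType d) (R : realType).
Variables (mu : {measure set X -> \bar R}) (f g : X -> R).
Hypotheses (mf : measurable_fun [set: X] f) (mg : measurable_fun [set: X] g).
Hypotheses (f0 : forall x, 0 <= f x) (g0 : forall x, 0 <= g x).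
Hypothesis gfin : (\int[mu]_x (g x)%:E < +oo)%E.
Hypothesis fgE : (\int[mu]_x (f x)%:E = \int[mu]_x (g x)%:E)%E.
Hypothesis fg : forall eta : R -> R, {homo eta : s t / s <= t} ->
  (forall t, 0 <= eta t) ->
  (\int[mu]_x (eta (g x) * g x)%:E <= \int[mu]_x (eta (f x) * f x)%:E)%E.

Let integrable_ge0 (h : X -> R) : measurable_fun [set: X] h ->
    (forall x, 0 <= h x) -> (\int[mu]_x (h x)%:E < +oo)%E ->
  mu.-integrable [set: X] (EFin \o h).
Proof.
move=> mh h0 hfin; apply/integrableP; split; first exact/measurable_EFinP.
by under eq_integral => x _ do rewrite gee0_abs ?lee_fin//.
Qed.

Let intf : mu.-integrable [set: X] (EFin \o f).
Proof. by apply: integrable_ge0 => //; rewrite fgE. Qed.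

Let intg : mu.-integrable [set: X] (EFin \o g).
Proof. exact: integrable_ge0. Qed.

(* [chi t - chi 0 = t * psi t] with [psi] nondecreasing and bounded by [C], so
   that [eta := psi + C] is a legitimate weight. *)
Lemma lipschitz_convex_integral (chi E : R -> R) (C : R) :
    (forall x, `|E x| <= C) ->
    (forall x y, 0 <= x -> 0 <= y -> chi x + E x * (y - x) <= chi y) ->
  mu.-integrable [set: X] (fun x => (chi (f x) - chi (g x))%:E) /\
  (0 <= \int[mu]_x (chi (f x) - chi (g x))%:E)%E.
Proof.
move=> EC subg.
(* The quotient lies between [E 0] and [E t], hence in [[-C, C]]. The value 0 for [t <= 0] keeps
   [eta] monotone on the whole line and is harmless at 0, where [eta t] is multiplied by [t]. *)
pose eta t := if 0 < t then (chi t - chi 0) / t + C else 0.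
have ECP x : - C <= E x <= C by rewrite -ler_norml.
have eta_bounds t : 0 <= eta t <= 2 * C.
  rewrite /eta; case: ltP => [t0|_]; last first.
    by have /andP[] := ECP 0; lra.
  have st : (chi t - chi 0) / t * t = chi t - chi 0 by rewrite divfK ?gt_eqF.
  have := subg 0 t (lexx 0) (ltW t0); have := subg t 0 (ltW t0) (lexx 0).
  have /andP[] := ECP 0; have /andP[] := ECP t.
  by move: ((_ - _) / _) st => q; nra.
have eta_homo : {homo eta : s t / s <= t}.
  move=> s t st; rewrite {1}/eta; case: ltP => [s0|_]; last first.
    by have /andP[] := eta_bounds t.
  have t0 := lt_le_trans s0 st; rewrite /eta t0 lerD2r.
  rewrite ler_pdivrMr// mulrAC ler_pdivlMr//.
  have := subg s t (ltW s0) (ltW t0); have := subg s 0 (ltW s0) (lexx 0).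
  nra.
have etaE t : 0 <= t -> chi t = eta t * t - C * t + chi 0.
  rewrite le_eqVlt => /predU1P[<-|t0]; first by ring.
  by rewrite /eta t0; field; rewrite gt_eqF.
have meta (h : X -> R) : measurable_fun [set: X] h ->
    measurable_fun [set: X] (fun x => eta (h x) * h x).
  move=> mh; apply: measurable_funM => //; apply: measurableT_comp => //.
  exact: nondecreasing_measurable.
have inteta (h : X -> R) : measurable_fun [set: X] h -> (forall x, 0 <= h x) ->
    mu.-integrable [set: X] (EFin \o h) ->
    mu.-integrable [set: X] (fun x => (eta (h x) * h x)%:E).
  move=> mh h0 ih; apply: (le_integrable measurableT _ _ (integrableZl measurableT (2 * C) ih)).
    exact/measurable_EFinP/meta.
  move=> x _ /=; rewrite lee_fin; have /andP[e0 e2] := eta_bounds (h x).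
  rewrite [leLHS]ger0_norm ?mulr_ge0// [leRHS]ger0_norm ?ler_wpM2r//.
  by apply: mulr_ge0 => //; exact: le_trans e2.
have ief := inteta f mf f0 intf; have ieg := inteta g mg g0 intg.
(* The constant [chi 0], which need not be integrable when [mu] is infinite, cancels before
   integration. *)
have kE x : (chi (f x) - chi (g x))%:E =
    ((eta (f x) * f x)%:E - (eta (g x) * g x)%:E -
     C%:E * ((f x)%:E - (g x)%:E))%E.
  suff -> : chi (f x) - chi (g x) =
    eta (f x) * f x - eta (g x) * g x - C * (f x - g x) by [].
  by rewrite (etaE (f x))// (etaE (g x))//; ring.
have ifg := integrableB measurableT intf intg.
have i1 := integrableB measurableT ief ieg.
have i2 := integrableZl measurableT C ifg.
have i3 := integrableB measurableT i1 i2.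
split; first by apply: (eq_integrable measurableT _ _ _ i3) => x _; rewrite kE.
have -> : (\int[mu]_x (chi (f x) - chi (g x))%:E =
    \int[mu]_x (eta (f x) * f x)%:E - \int[mu]_x (eta (g x) * g x)%:E -
    C%:E * (\int[mu]_x (f x)%:E - \int[mu]_x (g x)%:E))%E.
  rewrite -(integralB measurableT intf intg) -(integralZl measurableT ifg).
  rewrite -(integralB measurableT ief ieg) -(integralB measurableT i1 i2).
  by apply: eq_integral => x _; exact: kE.
rewrite fgE subee ?mule0 ?sube0; last exact: (integrable_fin_num measurableT intg).
rewrite sube_ge0; last by apply/orP; left; exact: (integrable_fin_num measurableT ieg).
by apply: fg => // t; have /andP[] := eta_bounds t.
Qed.

(** Fatou's lemma for the nonnegative [H - kn n] bounds the integral of [H - k] by that of [H],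
    because each [kn n] has nonnegative integral. As [H] is integrable, [k = H - (H - k)] is a
    difference of integrable functions with nonnegative integral. *)
Lemma majorized_of_weighted_integral : majorized mu g f.
Proof.
move=> phi cphi phi0 k kfin.
have [chi [chiP [K K0 chi_le] chi_cvg]] := convex_truncation cphi phi0.
pose kn n x := chi n (f x) - chi n (g x).
have knP n : mu.-integrable [set: X] (EFin \o kn n) /\
    (0 <= \int[mu]_x (kn n x)%:E)%E.
  by have [E [C EC subg]] := chiP n; exact: lipschitz_convex_integral EC subg.
have mkn n : measurable_fun [set: X] (EFin \o kn n).
  exact: measurable_int (knP n).1.
have kn_cvg x : (kn n x)%:E @[n --> \oo] --> k x.
  by apply: cvg_EFin; [exact: nearW|apply: cvgB; exact: chi_cvg].
have mk : measurable_fun [set: X] k.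
  by apply: (emeasurable_fun_cvg (fun n => EFin \o kn n)) => // x _; exact: kn_cvg.
(* If the positive part has infinite integral, the negative part has a finite one and the integral
   of [k] is +oo. Otherwise [k^\+] can enter an integrable majorant. *)
have [kpoo|] := eqVneq (\int[mu]_x k^\+ x)%E +oo%E.
  case: kfin; first by rewrite kpoo ltxx.
  rewrite [(\int[mu]_x k x)%E]integralE kpoo.
  by case: (\int[mu]_x k^\- x)%E => [r| |]//= _; rewrite leey.
rewrite -ltey => {}kfin.
pose H x := (k^\+ x + K%:E * ((f x)%:E + (g x)%:E))%E.
have ikp : mu.-integrable [set: X] k^\+%E.
  apply/integrableP; split; first exact: measurable_funepos.
  by under eq_integral => x _ do rewrite gee0_abs//.
have iH : mu.-integrable [set: X] H.
  by apply: integrableD => //; apply: integrableZl => //; exact: integrableD.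
have mH := measurable_int mu iH.
pose h x := Num.max (phi (f x) - phi (g x)) 0 + K * (f x + g x).
have HE x : H x = (h x)%:E by rewrite /H funeposE EFinD EFin_max.
have kn_le n x : ((kn n x)%:E <= H x)%E.
  by rewrite HE lee_fin; exact: chi_le.
have k_le x : (k x <= H x)%E.
  by apply: (cvge_to_le (kn_cvg x)); exact: nearW.
have mHk : measurable_fun [set: X] (fun x => H x - k x)%E.
  exact: emeasurable_funB.
have Hk_le : (\int[mu]_x (H x - k x) <= \int[mu]_x H x)%E.
  pose F n x := (H x - (kn n x)%:E)%E.
  have F0 n x : [set: X] x -> (0 <= F n x)%E by rewrite sube_ge0.
  have := fatou mu measurableT (fun n => emeasurable_funB mH (mkn n)) F0.
  rewrite (_ : (fun x => _) = fun x => (H x - k x)%E); last first.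
    apply/funext => x; apply: (cvg_limn_einf_sup _).1.
    by rewrite HE; exact: (cvgeB _ (cvg_cst _) (kn_cvg x)).
  move=> /le_trans; apply; rewrite limn_einf_lim.
  apply: lime_le; first exact: is_cvg_einfs.
  apply: nearW => n; apply: (@le_trans _ _ (\int[mu]_x F n x)%E).
    by apply: ereal_inf_lbound; exists n => /=.
  rewrite integralB//; last exact: (knP n).1.
  rewrite leeBlDr ?(integrable_fin_num measurableT (knP n).1)// leeDl//.
  exact: (knP n).2.
have iHk : mu.-integrable [set: X] (fun x => H x - k x)%E.
  apply/integrableP; split => //.
  under eq_integral => x _ do rewrite gee0_abs ?sube_ge0//.
  by rewrite (le_lt_trans Hk_le)// ltey_eq (integrable_fin_num measurableT iH).
rewrite (eq_integral (fun x => H x - (H x - k x))%E); last first.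
  by move=> x _; rewrite HE /k -!EFinB; congr EFin; ring.
by rewrite integralB// sube_ge0// (integrable_fin_num measurableT iH) orbT.
Qed.
End majorization.

(** * Weighted inequalities from the change of variables *)

Lemma le_of_change_of_variables (R : realType) (u g uT fT J : R) :
    0 <= u -> 0 <= g -> 0 <= fT ->
    u * g = uT * fT * J -> (1 <= ext_ratio u (uT * J))%E -> u * g != 0 ->
  g <= fT.
Proof.
move=> u0 g0 fT0; rewrite mulrAC => ugE + ug0.
have u_gt0 : 0 < u by rewrite lt_def u0 andbT; apply: contra_neq ug0 => ->; rewrite mul0r.
have ug_gt0 : 0 < u * g by rewrite lt_def ug0 mulr_ge0.
(* Positivity of [uT * J * fT = u * g] excludes a vanishing denominator, where [ext_ratio] would be
   +oo and carry no information. *)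
have uTJ_gt0 : 0 < uT * J by nra.
rewrite /ext_ratio gt_eqF// lee_fin ler_pdivlMr// mul1r => uTJu.
by rewrite -(ler_pM2l u_gt0) ugE ler_wpM2r.
Qed.

(* [J] plays the role of [abs_jac T]. *)
Lemma majorized_of_transport d (X : measurableType d) (R : realType)
    (nu : {measure set X -> \bar R}) (u f g J : X -> R) (T : X -> X)
    (u_meas : measurable_fun [set: X] u) (u_ge0 : forall x, 0 <= u x)
    (f_meas : measurable_fun [set: X] f) (f_ge0 : forall x, 0 <= f x)
    (g_meas : measurable_fun [set: X] g) (g_ge0 : forall x, 0 <= g x) :
    let mu := density_measure nu u_meas u_ge0 in
    (\int[mu]_x (g x)%:E < +oo)%E ->
    (\forall x \ae nu, u x * g x = u (T x) * f (T x) * J x) ->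
    (forall h : X -> R, measurable_fun [set: X] h -> (forall x, 0 <= h x) ->
      (\int[nu]_x (h (T x) * (u x * g x))%:E =
       \int[nu]_x (h x * (u x * f x))%:E)%E) ->
    (1 <= ess_inf nu (fun x => ext_ratio (u x) (u (T x) * J x)))%E ->
  majorized mu g f.
Proof.
move=> mu gfin ugE transport /ess_infP ratio.
have integral_mu (h : X -> R) :
    measurable_fun [set: X] h -> (forall x, 0 <= h x) ->
    (\int[mu]_x (h x)%:E = \int[nu]_x (h x * u x)%:E)%E.
  by move=> mh h0; rewrite ge0_integral_density_measure//; exact/measurable_EFinP.
have fgE : (\int[mu]_x (f x)%:E = \int[mu]_x (g x)%:E)%E.
  rewrite !integral_mu//; have := transport (fun=> 1) (measurable_cst _) (fun=> ler01).
  by under eq_integral do rewrite mul1r mulrC;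
     under [in X in _ = X -> _]eq_integral do rewrite mul1r mulrC.
apply: majorized_of_weighted_integral => // eta eta_homo eta0.
have meta (h : X -> R) :
    measurable_fun [set: X] h ->
    measurable_fun [set: X] (fun x => eta (h x)).
  by move=> mh; apply: measurableT_comp => //; exact: nondecreasing_measurable.
rewrite !integral_mu; try by move=> x; rewrite mulr_ge0.
- rewrite [leRHS](eq_integral (fun x : X => (eta (f x) * (u x * f x))%:E)); last first.
    by move=> x _; rewrite -mulrA (mulrC (f x)).
  have <- := transport (fun x => eta (f x)) (meta _ f_meas) (fun x => eta0 _).
  (* The transported integrand contains [f (T x)], whose measurability is not known; hence the
     comparison with a lower integral. *)
  apply: ae_le_lower_integral.
  + apply/measurable_EFinP; apply: measurable_funM => //.
    by apply: measurable_funM => //; exact: meta.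
  + by move=> x; rewrite lee_fin !mulr_ge0.
  + by move=> x; rewrite lee_fin !mulr_ge0.
  + apply: filterS2 ugE ratio => x ugE ratio; rewrite lee_fin.
    rewrite -mulrA (mulrC (g x)).
    (* Where [u g] vanishes both sides are 0; elsewhere [g x <= f (T x)] and [eta] is monotone. *)
    have [->|ug0] := eqVneq (u x * g x) 0; first by rewrite !mulr0.
    rewrite ler_wpM2r ?mulr_ge0//; apply: eta_homo.
    exact: le_of_change_of_variables ugE ratio ug0.
- by apply: measurable_funM => //; exact: meta.
- by apply: measurable_funM => //; exact: meta.
Qed.

Theorem lemma1p5 (R : realType) (n : nat) (u f g : 'rV[R]_n.+1 -> R)
  (u_meas : lebesgue_measurable u) (u_ge0 : forall x, 0 <= u x)
  (f_meas : lebesgue_measurable f) (f_ge0 : forall x, 0 <= f x)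
  (g_meas : lebesgue_measurable g) (g_ge0 : forall x, 0 <= g x) :
  let mu := density_measure (lebesgue_mu R n) u_meas u_ge0 in
  (\int[mu]_x (g x)%:E < +oo)%E ->
  (exists T : 'rV[R]_n.+1 -> 'rV[R]_n.+1,
    change_of_variables (fun x => u x * g x) (fun x => u x * f x) T /\
    (1 <= ess_inf (lebesgue_mu R n)
            (fun x => ext_ratio (u x) (u (T x) * abs_jac T x)))%E) ->
  majorized mu g f.
Proof.
move=> mu gfin [T [[_ _ ugE transport] ratio]].
exact: majorized_of_transport gfin ugE transport ratio.
Qed.
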